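(* Let $\sigma$ be a term ordering on the power products of $\mathbb{R}[x_1,\dots,x_s]$, let $\epsilon>0$ be a threshold, and let $\overline{\mathcal P}=\{\overline p_1,\dots,\overline p_m\}\subset\mathbb{R}^s$ be the set of preprocessed points (see the context). Let $\overline{\mathcal N}$ and $\overline{GB}=\{\overline g_1,\dots,\overline g_n\}$ be the output of the ABM algorithm (described in the context) on input $(\sigma,\overline{\mathcal P},\epsilon)$, where $\overline{\mathcal N}=\{\overline t_1,\dots,\overline t_m\}$ has $m$ elements. Let $\mathcal C[\overline{\mathcal N}]$ be the corner set of $\overline{\mathcal N}$, let $\overline M_m(\overline{\mathcal P})=[\overline t_1(\overline{\mathcal P}),\dots,\overline t_m(\overline{\mathcal P})]$ be the $m\times m$ matrix whose columns are the evaluation vectors of the terms of $\overline{\mathcal N}$, and let $\sigma_{\min}$ be its minimum singular value. Put $$S=\overline{\mathcal N}\cup\mathcal C[\overline{\mathcal N}],\qquad \delta_i=\frac{\|\overline g_i(\overline{\mathcal P})\|_2}{\sigma_{\min}}\quad (i=1,\dots,n).$$ Then the points of $\overline{\mathcal P}$ are pseudozeros of the system $\overline g_1=0,\dots,\overline g_n=0$ consisting of the polynomials of $\overline{GB}$, with respect to $S$ and with tolerances $\mathcal D=\{\delta_1,\dots,\delta_n\}$; that is, $\overline{\mathcal P}$ is a set of pseudozeros for this system in the sense defined in the context.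
   Context: Preprocessed points: the input data are points whose coordinates are known only up to an error estimate $s_0$. Preprocessing replaces coordinates that differ by less than the error estimate by a single representative value, giving the set $\overline{\mathcal P}$; the resulting set depends on the preprocessing technique used. For a polynomial $g$ and a tuple of points $\mathcal P=\{p_1,\dots,p_m\}$, $g(\mathcal P)=(g(p_1),\dots,g(p_m))^T\in\mathbb{R}^m$. A term (power product) is a monomial $x_1^{j_1}\cdots x_s^{j_s}$ with coefficient 1. ABM algorithm. Input: a term ordering $\sigma$, the preprocessed points $\overline{\mathcal P}=\{\overline p_1,\dots,\overline p_m\}$, a threshold $\epsilon>0$. Output: a set of polynomials $\overline{GB}$ and a set of power products $\overline{\mathcal N}$, both initially empty. The terms are chosen as in the Buchberger-Möller algorithm: start with the list $L=\{1\}$; at each step remove from $L$ its $\sigma$-smallest element $\overline t$ and process it as follows; stop when $L$ is empty. Let $\overline t_1,\dots,\overline t_k$ be the terms currently in $\overline{\mathcal N}$ (all are $<_\sigma\overline t$) and let $\overline M_k(\overline{\mathcal P})=[\overline t_1(\overline{\mathcal P}),\dots,\overline t_k(\overline{\mathcal P})]$. Solve the least squares problem $\overline M_k(\overline{\mathcal P})\,\overline c=\overline t(\overline{\mathcal P})$ and let $\overline r=\overline t(\overline{\mathcal P})-\overline M_k(\overline{\mathcal P})\,\overline c$ be its residual (for $k=0$, $\overline r=\overline t(\overline{\mathcal P})$). If $\|\overline r\|_2/\|\overline t(\overline{\mathcal P})\|_2>\epsilon$, put $\overline t$ into $\overline{\mathcal N}$ and add to $L$ those of $x_1\overline t,\dots,x_s\overline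 t$ that are not multiples of a leading term of an element of $\overline{GB}$. Otherwise, put the polynomial $\overline g=\overline t-\sum_{i=1}^k\overline c_i\,\overline t_i$ (with leading term $\overline t$) into $\overline{GB}$ and remove from $L$ all multiples of $\overline t$. Corner set: for a set $\mathcal N$ of power products closed under taking divisors, $\mathcal C[\mathcal N]$ is the set of power products $t\notin\mathcal N$ all of whose proper divisors belong to $\mathcal N$. Pseudozeros: let $S$ be a set of power products, let $g=\sum_{x^j\in S}a_jx^j$ and let $\delta$ be a tolerance. Define $$N_S(g,\delta)=\Big\{\tilde g:\ \tilde g(x)=\sum_{x^j\in S}\tilde a_jx^j,\ |\tilde a_j-a_j|<\delta\Big\}.$$ A point $p$ is a pseudozero of $g$ with respect to $S$ and tolerance $\delta$ if it is an exact zero of some $\tilde g\in N_S(g,\delta)$. A set of points $\mathcal P$ is a set of pseudozeros of $g$ with respect to $S$ and tolerance $\delta$ if it is a set of exact zeros of some (single) $\tilde g\in N_S(g,\delta)$. A set of points $\mathcal P$ is a set of pseudozeros for a system of $n$ polynomials $g_1,\dots,g_n$, whose supports belong to $S$, with respect to $S$ and tolerances $\{\delta_1,\dots,\delta_n\}$ if, for each $i$, it is a set of pseudozeros of $g_i$ with respect to $S$ and tolerance $\delta_i$.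
   Formalization: For tolerance δ = 0 the set N_S(g,0), empty under the strict inequality (so the claim fails when some g_i vanishes on the points), is read as {g}, i.e. exact zeros; in the algorithm a ratio 0/0, for a term vanishing at all points, is read as 0. *)

(* Defs.v *)
From HB Require Import structures.
From mathcomp Require Import all_boot all_order all_algebra.
From mathcomp Require Import finmap mpoly reals.

Set Implicit Arguments.
Unset Strict Implicit.
Unset Printing Implicit Defensive.

Import Order.TTheory GRing.Theory Num.Theory.

Local Open Scope ring_scope.
Local Open Scope fset_scope.

(* Power products x_1^{j_1} ... x_s^{j_s} are identified with their exponent
   vectors 'X_{1..s}: 0%MM is the term 1, (_ + _)%MM is the product of terms
   and (u <= t)%MM is divisibility. *)

Record term_ordering (s : nat) (le : rel 'X_{1..s}) : Prop := TermOrdering {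
  to_refl : reflexive le;
  to_anti : antisymmetric le;
  to_trans : transitive le;
  to_total : total le;
  to_one : forall t, le 0%MM t;
  to_mul : forall u v w, le u v -> le (u + w)%MM (v + w)%MM }.

(* The value 0%MM at g = 0 is a junk value. *)
Definition lead_term (R : realType) (s : nat) (le : rel 'X_{1..s})
    (g : {mpoly R[s]}) : 'X_{1..s} :=
  last 0%MM (sort le (msupp g)).

Definition norm2 (R : realType) (m : nat) (v : 'cV[R]_m) : R :=
  Num.sqrt (\sum_i v i 0 ^+ 2).

Definition evalv (R : realType) (s m : nat) (P : 'I_m -> 'rV[R]_s)
    (g : {mpoly R[s]}) : 'cV[R]_m :=
  \col_i g.@[P i 0].

Definition evalmx (R : realType) (s m k : nat) (P : 'I_m -> 'rV[R]_s)
    (N : k.-tuple 'X_{1..s}) : 'M[R]_(m, k) :=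
  \matrix_(i, j) evalv P 'X_[tnth N j] i 0.

Definition least_squares (R : realType) (m k : nat) (A : 'M[R]_(m, k))
    (b : 'cV[R]_m) (c : 'cV[R]_k) : Prop :=
  forall c' : 'cV[R]_k, norm2 (b - A *m c) <= norm2 (b - A *m c').

Definition singular_value (R : realType) (m k : nat) (A : 'M[R]_(m, k))
    (x : R) : Prop :=
  0 <= x /\ eigenvalue (A^T *m A) (x ^+ 2).

Definition min_singular_value (R : realType) (m k : nat) (A : 'M[R]_(m, k))
    (x : R) : Prop :=
  singular_value A x /\ forall y, singular_value A y -> x <= y.

(* abm_N lists the terms in the order in which they were found, so that the
   j-th column of the evaluation matrix belongs to the j-th term. *)
Record abm_state (R : realType) (s : nat) : Type := AbmState {
  abm_L : {fset 'X_{1..s}};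
  abm_GB : seq {mpoly R[s]};
  abm_N : seq 'X_{1..s} }.

Definition new_terms (R : realType) (s : nat) (le : rel 'X_{1..s})
    (GB : seq {mpoly R[s]}) (t : 'X_{1..s}) : seq 'X_{1..s} :=
  [seq u <- [seq (U_(i) + t)%MM | i <- enum 'I_s]
     | ~~ has (fun g => (lead_term le g <= u)%MM) GB].

(* When t vanishes at all the points the ratio reads 0 / 0 = 0 and t is
   treated as the leading term of an almost vanishing polynomial. *)
Inductive abm_step (R : realType) (s m : nat) (le : rel 'X_{1..s})
    (P : 'I_m -> 'rV[R]_s) (eps : R) : abm_state R s -> abm_state R s -> Prop :=
| abm_step_N (L : {fset 'X_{1..s}}) GB N t (c : 'cV[R]_(size N)) :
    let A := evalmx P (in_tuple N) in
    let b := evalv P 'X_[t] in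
    t \in L -> (forall u, u \in L -> le t u) ->
    least_squares A b c ->
    eps < norm2 (b - A *m c) / norm2 b ->
    abm_step le P eps (AbmState L GB N)
      (AbmState ((L `\ t) `|` [fset u in new_terms le GB t]) GB (rcons N t))
| abm_step_GB (L : {fset 'X_{1..s}}) GB N t (c : 'cV[R]_(size N)) :
    let A := evalmx P (in_tuple N) in
    let b := evalv P 'X_[t] in
    let g := 'X_[t] - \sum_(i < size N) c i 0 *: 'X_[tnth (in_tuple N) i] in
    t \in L -> (forall u, u \in L -> le t u) ->
    least_squares A b c ->
    ~~ (eps < norm2 (b - A *m c) / norm2 b) ->
    abm_step le P eps (AbmState L GB N)
      (AbmState [fset u in L | ~~ (t <= u)%MM] (rcons GB g) N).

Inductive abm_reachable (R : realType) (s m : nat) (le : rel 'X_{1..s})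
    (P : 'I_m -> 'rV[R]_s) (eps : R) : abm_state R s -> Prop :=
| abm_init : abm_reachable le P eps (AbmState [fset 0%MM] [::] [::])
| abm_next x y :
    abm_reachable le P eps x -> abm_step le P eps x y ->
    abm_reachable le P eps y.

Definition abm_output (R : realType) (s m : nat) (le : rel 'X_{1..s})
    (P : 'I_m -> 'rV[R]_s) (eps : R)
    (GB : seq {mpoly R[s]}) (N : seq 'X_{1..s}) : Prop :=
  abm_reachable le P eps (AbmState fset0 GB N).

Definition corner_set (s : nat) (N : seq 'X_{1..s}) (t : 'X_{1..s}) : Prop :=
  t \notin N /\ forall u, (u <= t)%MM -> u != t -> u \in N.

Definition supported (R : realType) (s : nat) (S : 'X_{1..s} -> Prop)
    (g : {mpoly R[s]}) : Prop :=
  forall j, j \in msupp g -> S j.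

(* For delta > 0 this is the open neighbourhood |a~_j - a_j| < delta. For
   delta = 0 no polynomial satisfies the strict inequality (unless S is empty);
   tolerance 0 is read as "no perturbation", i.e. the neighbourhood is {g}. *)
Definition coef_nbhd (R : realType) (s : nat) (S : 'X_{1..s} -> Prop)
    (g : {mpoly R[s]}) (delta : R) (g' : {mpoly R[s]}) : Prop :=
  supported S g' /\
  forall j, S j ->
    if delta == 0 then g'@_j = g@_j else `|g'@_j - g@_j| < delta.

Definition pseudozero_set (R : realType) (s m : nat) (S : 'X_{1..s} -> Prop)
    (g : {mpoly R[s]}) (delta : R) (P : 'I_m -> 'rV[R]_s) : Prop :=
  exists g', coef_nbhd S g delta g' /\ forall k, g'.@[P k 0] = 0.

Definition pseudozero_set_system (R : realType) (s m n : nat)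
    (S : 'X_{1..s} -> Prop) (g : n.-tuple {mpoly R[s]}) (delta : 'I_n -> R)
    (P : 'I_m -> 'rV[R]_s) : Prop :=
  forall i, supported S (tnth g i) /\ pseudozero_set S (tnth g i) (delta i) P.

(* Main.v *)
Require Import Defs.
From mathcomp Require Import all_boot all_order all_algebra.
From mathcomp Require Import finmap mpoly reals.
From mathcomp Require classical_sets.
From mathcomp Require Import ring lra.

Set Implicit Arguments.
Unset Strict Implicit.
Unset Printing Implicit Defensive.

Import Order.TTheory GRing.Theory Num.Theory.

Local Open Scope ring_scope.

(* Each term enters [N] with a nonzero residual, so the evaluation matrix [M] is
   invertible and [g(P) = M d] has a solution, with [|d| <= |g(P)| / sigma_min]
   because the least eigenvalue of [M^T M] bounds its Rayleigh quotient from
   below.  Subtracting the combination [d] of the terms of [N] from [g] thus gives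
   an exactly vanishing polynomial within the tolerances, up to strictness.  The
   leading term of [g] is a corner of [N] because every term is in [N], or is a
   multiple of a leading term of [GB] or of a term still in [L]. *)

(** * Euclidean norm of real column vectors *)

Section EuclideanNorm.
Variables (R : realType) (m : nat).
Implicit Types v : 'cV[R]_m.

Lemma norm2_ge0 v : 0 <= norm2 v.
Proof. exact: sqrtr_ge0. Qed.

Lemma sqr_norm2 v : norm2 v ^+ 2 = \sum_i v i 0 ^+ 2.
Proof. by rewrite sqr_sqrtr // sumr_ge0 // => i _; rewrite sqr_ge0. Qed.

Lemma norm2_eq0 v : (norm2 v == 0) = (v == 0).
Proof.
rewrite -sqrf_eq0 sqr_norm2 psumr_eq0; last by move=> i _; exact: sqr_ge0.
apply/allP/eqP => [v0|-> i _]; last by rewrite /= mxE expr0n.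
apply/matrixP => i j; rewrite ord1 mxE; apply/eqP.
by rewrite -sqrf_eq0; exact: v0 (mem_index_enum i).
Qed.

Lemma norm2_0 : norm2 (0 : 'cV[R]_m) = 0.
Proof. by apply/eqP; rewrite norm2_eq0. Qed.

Lemma norm2_gt0 v : (0 < norm2 v) = (v != 0).
Proof. by rewrite lt_def norm2_ge0 norm2_eq0 andbT. Qed.

Lemma norm_coord_le_norm2 v i : `|v i 0| <= norm2 v.
Proof.
rewrite -ler_sqr ?nnegrE ?norm2_ge0 // sqr_norm2 real_normK ?num_real //.
by rewrite (bigD1 i) //= lerDl sumr_ge0 // => j _; rewrite sqr_ge0.
Qed.

(** The squares of the remaining coordinates sum to zero. This serves the boundary case where a
    coefficient perturbation attains its tolerance. *)
Lemma norm2_le_coord v i k : norm2 v <= `|v i 0| -> k != i -> v k 0 = 0.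
Proof.
rewrite -ler_sqr ?nnegrE ?norm2_ge0 // sqr_norm2 real_normK ?num_real //.
rewrite (bigD1 i) //= gerDl => s_le0 ki.
have : \sum_(j | j != i) v j 0 ^+ 2 == 0.
  by rewrite eq_le s_le0 sumr_ge0 // => j _; rewrite sqr_ge0.
rewrite psumr_eq0 => [/allP/(_ k (mem_index_enum _))/=|j _]; last exact: sqr_ge0.
by rewrite ki sqrf_eq0 => /eqP.
Qed.

End EuclideanNorm.

(** * Bilinear forms of square matrices *)

Section BilinearForms.
Variables (R : realType) (n : nat).
Implicit Types (C : 'M[R]_n) (x y : 'cV[R]_n).

Definition bform C x y : R := (x^T *m C *m y) 0 0.

Lemma bform_sum C x y : bform C x y = \sum_i \sum_j x i 0 * C i j * y j 0.
Proof.
rewrite /bform mxE exchange_big /=; apply: eq_bigr => j _.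
by rewrite mxE big_distrl /=; apply: eq_bigr => i _; rewrite !mxE.
Qed.

Lemma bform1 x : bform 1%:M x x = norm2 x ^+ 2.
Proof.
rewrite sqr_norm2 /bform mulmx1 mxE.
by apply: eq_bigr => i _; rewrite mxE expr2.
Qed.

Lemma bformDl C x x' y : bform C (x + x') y = bform C x y + bform C x' y.
Proof. by rewrite /bform linearD /= !mulmxDl mxE. Qed.

Lemma bformDr C x y y' : bform C x (y + y') = bform C x y + bform C x y'.
Proof. by rewrite /bform mulmxDr mxE. Qed.

Lemma bformZl C a x y : bform C (a *: x) y = a * bform C x y.
Proof. by rewrite /bform linearZ /= -!scalemxAl mxE. Qed.

Lemma bformZr C a x y : bform C x (a *: y) = a * bform C x y.
Proof. by rewrite /bform -scalemxAr mxE. Qed.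

Lemma bformB C C' x y : bform (C - C') x y = bform C x y - bform C' x y.
Proof. by rewrite /bform mulmxBr mulmxBl !mxE. Qed.

Lemma bform_scalar a x : bform a%:M x x = a * norm2 x ^+ 2.
Proof. by rewrite -scalemx1 -bform1 /bform -scalemxAr -scalemxAl mxE. Qed.

Lemma bform_sym C x y : C^T = C -> bform C x y = bform C y x.
Proof.
(* A 1 x 1 matrix equals its transpose: the left side is read as an entry of the transpose, which
   reverses the product. *)
move=> symC; rewrite /bform -{1}symC -[LHS](mxE trmx_key (fun i j => _ j i)).
by rewrite -/(trmx _) !trmx_mul !trmxK mulmxA.
Qed.

End BilinearForms.

(** * Positive semidefinite forms and least eigenvalues *)

Section PositiveForms.
Variables (R : realType) (n : nat).
Implicit Types (C : 'M[R]_n) (x y : 'cV[R]_n).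

Lemma bform_gram m (A : 'M[R]_(m, n)) x :
  bform (A^T *m A) x x = norm2 (A *m x) ^+ 2.
Proof. by rewrite -bform1 /bform mulmx1 trmx_mul !mulmxA. Qed.

(** The form at [a *: x + b *: y] is a nonnegative quadratic in [(a, b)]. As [C] may be singular,
    [bform C y y = 0] is possible for nonzero [y] and is treated separately. *)
Lemma bform_CauchySchwarz C x y :
  C^T = C -> (forall z, 0 <= bform C z z) ->
  bform C x y ^+ 2 <= bform C x x * bform C y y.
Proof.
move=> symC psd.
have disc a b : 0 <= a ^+ 2 * bform C x x + 2 * (a * b) * bform C x y
                     + b ^+ 2 * bform C y y.
  have := psd (a *: x + b *: y).
  rewrite !(bformDl, bformDr, bformZl, bformZr) (bform_sym y x symC).
  by congr (0 <= _); ring.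
move: (psd x) (psd y) disc.
move: (bform C x x) (bform C x y) (bform C y y) => X Z Y X0 Y0 disc.
have [Y_gt0|Y_le0] := ltP 0 Y.
  (* This choice of [(a, b)] leaves [Y] times the desired difference. *)
  have := disc Y (- Z).
  have -> : Y ^+ 2 * X + 2 * (Y * - Z) * Z + (- Z) ^+ 2 * Y
            = Y * (X * Y - Z ^+ 2) by ring.
  by rewrite pmulr_rge0 // subr_ge0.
have {Y0 Y_le0} Y0 : Y = 0 by apply: le_anti; rewrite Y0 Y_le0.
(* With [Y = 0] the cross term now outweighs [Z ^+ 2 * X], which forces [Z = 0]. *)
have := disc Z (- (X + 1)); rewrite Y0 (mulr0 X).
have -> : Z ^+ 2 * X + 2 * (Z * - (X + 1)) * Z + (- (X + 1)) ^+ 2 * 0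
            = - ((X + 2) * Z ^+ 2) by ring.
by rewrite oppr_ge0 pmulr_rle0 //; lra.
Qed.

(** A crude entrywise estimate; the summand 1 in the constant keeps it positive, hence invertible,
    even for [C = 0]. *)
Lemma bform_upper_bound C :
  exists2 K, 0 < K & forall x, bform C x x <= K * norm2 x ^+ 2.
Proof.
exists (1 + \sum_i \sum_j `|C i j|).
  by rewrite ltr_pwDl // !sumr_ge0 // => i _; rewrite sumr_ge0.
move=> x; rewrite mulrDl mul1r bform_sum ler_wpDl ?sqr_ge0 //.
rewrite big_distrl /=; apply: ler_sum => i _.
rewrite big_distrl /=; apply: ler_sum => j _.
apply: le_trans (ler_norm _) _.
rewrite !normrM mulrAC mulrC expr2 ler_wpM2l //.
by rewrite ler_pM // norm_coord_le_norm2.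
Qed.

(* Cauchy-Schwarz at [x] and [C^-1 x] bounds [(x^T x)^2] by
   [(x^T C x) (x^T C^-1 x)]. *)
Lemma psd_unit_coercive C :
  C^T = C -> C \in unitmx -> (forall z, 0 <= bform C z z) ->
  exists2 e, 0 < e & forall x, e * norm2 x ^+ 2 <= bform C x x.
Proof.
move=> symC unitC psd.
have [K K_gt0 bound] := bform_upper_bound (invmx C).
exists K^-1; rewrite ?invr_gt0 // => x.
rewrite ler_pdivrMl //.
have := bform_CauchySchwarz x (invmx C *m x) symC psd.
have -> : bform C x (invmx C *m x) = norm2 x ^+ 2.
  by rewrite -bform1 /bform mulmx1 mulmxA mulmxK.
have -> : bform C (invmx C *m x) (invmx C *m x) = bform (invmx C) x x.
  by rewrite /bform trmx_mul trmx_inv symC -!mulmxA mulKVmx.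
move=> CS; have [->|x0] := eqVneq (norm2 x) 0.
  by rewrite expr0n /= mulr_ge0 // ltW.
have n_gt0 : 0 < norm2 x ^+ 2 by rewrite exprn_gt0 // lt_def x0 norm2_ge0.
rewrite -(ler_pM2r n_gt0) -expr2 (le_trans CS) //.
by rewrite [K * _]mulrC -mulrA ler_wpM2l // psd.
Qed.

(* The supremum of the [a] with [a |x|^2 <= x^T C x] is an eigenvalue: if
   [C - a] were invertible, it would be coercive and [a] could be increased. *)
Lemma psd_min_eigenvalue C : (0 < n)%N ->
  C^T = C -> (forall z, 0 <= bform C z z) ->
  exists a, [/\ 0 <= a, eigenvalue C a
             & forall x, a * norm2 x ^+ 2 <= bform C x x].
Proof.
move=> n_gt0 symC psd.
pose E : classical_sets.set R :=
  fun a => forall x, a * norm2 x ^+ 2 <= bform C x x.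
have E0 : E 0 by move=> x; rewrite mul0r.
have norm_gt0 x : x != 0 -> 0 < norm2 x ^+ 2.
  by move=> x0; rewrite exprn_gt0 // norm2_gt0.
have ubE x : x != 0 -> classical_sets.ubound E (bform C x x / norm2 x ^+ 2).
  by move=> x0 a Ea; rewrite ler_pdivlMr ?norm_gt0.
have supE : classical_sets.has_sup E.
  split; first by exists 0.
  (* Any nonzero vector bounds [E] by its Rayleigh quotient; the all-ones vector is nonzero because
     [n] is positive. *)
  pose x : 'cV[R]_n := const_mx 1; exists (bform C x x / norm2 x ^+ 2).
  apply: ubE; apply/eqP => /matrixP/(_ (Ordinal n_gt0) 0)/eqP.
  by rewrite !mxE oner_eq0.
have Esup : E (sup E).
  move=> x; have [->|x0] := eqVneq x 0.
    by rewrite norm2_0 expr0n mulr0 psd.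
  by rewrite -ler_pdivlMr ?norm_gt0 //; apply: ge_sup; [exists 0|exact: ubE].
exists (sup E); split=> //; first exact: sup_upper_bound.
rewrite /eigenvalue kermx_eq0 row_free_unit; apply/negP => unitC.
have symC' : (C - (sup E)%:M)^T = C - (sup E)%:M.
  by rewrite linearB /= symC tr_scalar_mx.
have psd' z : 0 <= bform (C - (sup E)%:M) z z.
  by rewrite bformB bform_scalar subr_ge0.
have [e e_gt0 coer] := psd_unit_coercive symC' unitC psd'.
have : E (sup E + e).
  move=> x; have := coer x.
  by rewrite bformB bform_scalar lerBrDl mulrDl.
by move/(sup_upper_bound supE); rewrite gerDl leNgt e_gt0.
Qed.

End PositiveForms.

(** The eigenvalue [b] of the Gram matrix given by [psd_min_eigenvalue] bounds the Rayleigh quotient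
    below, and its root is a singular value, so [a <= Num.sqrt b]. *)
Lemma min_singular_value_le (R : realType) (m k : nat) (A : 'M[R]_(m, k))
    (a : R) (x : 'cV[R]_k) :
  min_singular_value A a -> a * norm2 x <= norm2 (A *m x).
Proof.
case=> -[a_ge0 /eigenvalueP[v _ v0]] min_a.
have k_gt0 : (0 < k)%N.
  by case: (k) v v0 => // v; rewrite thinmx0 eqxx.
have psd (z : 'cV[R]_k) : 0 <= bform (A^T *m A) z z.
  by rewrite bform_gram sqr_ge0.
have sym : (A^T *m A)^T = A^T *m A by rewrite trmx_mul trmxK.
have [b [b_ge0 eig_b bound]] := psd_min_eigenvalue k_gt0 sym psd.
have le_ab : a <= Num.sqrt b.
  by apply: min_a; split; rewrite ?sqrtr_ge0 ?sqr_sqrtr.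
rewrite -ler_sqr ?nnegrE ?mulr_ge0 ?norm2_ge0 // -bform_gram exprMn.
apply: le_trans (bound x); rewrite ler_wpM2r ?sqr_ge0 //.
by rewrite -[b]sqr_sqrtr // ler_sqr ?nnegrE ?sqrtr_ge0.
Qed.

Lemma singular_value_unit_neq0 (R : realType) (m : nat) (A : 'M[R]_m) (a : R) :
  A \in unitmx -> singular_value A a -> a != 0.
Proof.
move=> unitA [_ /eigenvalueP[v eig v0]]; apply: contraNneq v0 => a0.
move: eig; rewrite a0 expr0n scale0r => /(congr1 (mulmx^~ (invmx (A^T *m A)))).
by rewrite mulmxK ?mul0mx ?unitmx_mul ?unitmx_tr ?unitA // => ->.
Qed.

(** * Evaluation of polynomials at the points *)

Section Evaluation.
Variables (R : realType) (s m : nat) (P : 'I_m -> 'rV[R]_s).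
Implicit Types (f g : {mpoly R[s]}) (t u : 'X_{1..s}).

Lemma evalvB f g : evalv P (f - g) = evalv P f - evalv P g.
Proof. by apply/matrixP => i j; rewrite !mxE mevalB. Qed.

Lemma evalvZ a g : evalv P (a *: g) = a *: evalv P g.
Proof. by apply/matrixP => i j; rewrite !mxE mevalZ. Qed.

Lemma evalv_eq0P g : evalv P g = 0 <-> forall k, g.@[P k 0] = 0.
Proof.
split=> [/matrixP g0 k|g0]; first by have := g0 k 0; rewrite !mxE.
by apply/matrixP => i j; rewrite !mxE.
Qed.

Definition lincomb k (N : k.-tuple 'X_{1..s}) (c : 'cV[R]_k) : {mpoly R[s]} :=
  \sum_(i < k) c i 0 *: 'X_[tnth N i].

Lemma evalv_lincomb k (N : k.-tuple 'X_{1..s}) c :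
  evalv P (lincomb N c) = evalmx P N *m c.
Proof.
apply/matrixP => i j; rewrite !mxE raddf_sum /=; apply: eq_bigr => l _.
by rewrite !mxE mevalZ mulrC ord1.
Qed.

Lemma msupp_lincomb k (N : k.-tuple 'X_{1..s}) c :
  {subset msupp (lincomb N c) <= N}.
Proof.
move=> t; rewrite mcoeff_msupp raddf_sum /=; apply: contraR => tN.
apply/eqP; apply: big1 => i _; rewrite mcoeffZ mcoeffX.
by case: eqP => [ti|]; rewrite ?mulr0 //; rewrite -ti mem_tnth in tN.
Qed.

Lemma mcoeff_lincomb k (N : k.-tuple 'X_{1..s}) c i :
  uniq N -> (lincomb N c)@_(tnth N i) = c i 0.
Proof.
move=> uN; rewrite raddf_sum (bigD1 i) //= mcoeffZ mcoeffX eqxx mulr1.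
rewrite big1 ?addr0 // => j ji; rewrite mcoeffZ mcoeffX.
by rewrite (inj_eq (elimT (tuple_uniqP N) uN)) (negbTE ji) mulr0.
Qed.

Lemma lincombE k (N : k.-tuple 'X_{1..s}) g : uniq N ->
  {subset msupp g <= N} -> g = lincomb N (\col_i g@_(tnth N i)).
Proof.
move=> uN gN; apply/mpolyP => t; have [/tnthP[i ->]|tN] := boolP (t \in N).
  by rewrite mcoeff_lincomb // mxE.
rewrite !memN_msupp_eq0 //; apply: contra tN; first exact: msupp_lincomb.
exact: gN.
Qed.

Lemma least_squares_poly k (N : k.-tuple 'X_{1..s}) t c g : uniq N ->
  {subset msupp g <= N} ->
  least_squares (evalmx P N) (evalv P 'X_[t]) c ->
  norm2 (evalv P ('X_[t] - lincomb N c)) <= norm2 (evalv P ('X_[t] - g)).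
Proof.
move=> uN gN ls; rewrite (lincombE uN gN) !evalvB !evalv_lincomb; exact: ls.
Qed.

(** A kernel vector of this square matrix is the coefficient vector of a polynomial vanishing at all
    the points. *)
Lemma evalmx_unit (N : m.-tuple 'X_{1..s}) : uniq N ->
  (forall g, {subset msupp g <= N} -> evalv P g = 0 -> g = 0) ->
  evalmx P N \in unitmx.
Proof.
move=> uN inj; rewrite -unitmx_tr -row_free_unit; apply: inj_row_free => v v0.
have Mv0 : evalmx P N *m v^T = 0.
  by apply: trmx_inj; rewrite trmx_mul trmxK v0 trmx0.
have := inj _ (msupp_lincomb (c := v^T)).
rewrite evalv_lincomb => /(_ Mv0) l0; apply/matrixP => i j.
by rewrite ord1 -[v]trmxK mxE -(mcoeff_lincomb _ _ uN) l0 mcoeff0 mxE.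
Qed.

End Evaluation.

(** * Term orderings and divisibility *)

Section TermOrderings.
Variables (s : nat) (le : rel 'X_{1..s}).
Hypothesis ord : term_ordering le.
Implicit Types (t u v : 'X_{1..s}).

Lemma term_ordering_dvd u t : (u <= t)%MM -> le u t.
Proof.
by move=> ut; rewrite -(submK ut) -{1}[u]add0m; apply/(to_mul ord)/(to_one ord).
Qed.

Lemma lead_term_eq (R : realType) (g : {mpoly R[s]}) t :
  t \in msupp g -> (forall u, u \in msupp g -> le u t) -> lead_term le g = t.
Proof.
rewrite /lead_term => tg gt; set r := sort le (msupp g).
have mem_r : r =i msupp g by exact: mem_sort.
have r_sorted : sorted le r by exact/sort_sorted/(to_total ord).
have r_gt0 : (0 < size r)%N by case: (r) (mem_r t); rewrite ?tg.
have last_r : last 0%MM r = nth 0%MM r (size r).-1 by rewrite nth_last.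
apply: (to_anti ord); apply/andP; split.
  by apply: gt; rewrite -mem_r last_r mem_nth // prednK.
have tr : t \in r by rewrite mem_r.
rewrite last_r -{1}(nth_index 0%MM tr).
have ir : (index t r < size r)%N by rewrite index_mem.
apply: (sorted_leq_nth (to_trans ord) (to_refl ord)) => //.
  by rewrite inE prednK.
by rewrite -ltnS prednK.
Qed.

(** Some exponent of [u] exceeds that of [t]. Hence the successors of a processed term cover all its
    proper multiples. *)
Lemma dvd_succ_term t u : (t <= u)%MM -> t != u ->
  exists i, (U_(i) + t <= u)%MM.
Proof.
move=> /mnm_lepP tu t_neq; apply/existsP; apply: contraNT t_neq.
move=> /existsPn no_succ; apply/eqP/mnmP => i; apply/eqP.
rewrite eqn_leq tu leqNgt; apply: contra (no_succ i) => ti.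
apply/mnm_lepP => j; rewrite mnmDE mnm1E.
by case: eqP => [<-|_]; rewrite ?add1n ?add0n.
Qed.

Lemma succ_term_neq i t : (U_(i) + t)%MM != t.
Proof.
apply/eqP => /mnmP/(_ i)/eqP.
by rewrite mnmDE mnm1E eqxx -{2}[t i]add0n eqn_add2r.
Qed.

End TermOrderings.

(** * Invariant of the ABM algorithm *)

Section AbmInvariant.
Variables (R : realType) (s m : nat) (le : rel 'X_{1..s}).
Variables (P : 'I_m -> 'rV[R]_s) (eps : R).
Hypothesis ord : term_ordering le.
Hypothesis eps_gt0 : 0 < eps.
Implicit Types (L : {fset 'X_{1..s}}) (GB : seq {mpoly R[s]}).
Implicit Types (N : seq 'X_{1..s}) (t u v : 'X_{1..s}) (f g h : {mpoly R[s]}).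

(* The last conjunct is all that is used of the least squares property; being
   relative to the support of [f], it survives later extensions of [N]. *)
Definition almost_vanishing N g : Prop :=
  exists t f, [/\ g = 'X_[t] - f, corner_set N t, {subset msupp f <= N},
    lead_term le g = t &
    forall u a, u \in msupp f ->
      norm2 (evalv P g) <= norm2 (evalv P (g - a *: 'X_[u]))].

(** [inv_cover], [inv_L_GB] and [inv_N_L] make the least term of [L] a corner of [N]; [inv_uniq] and
    [inv_inj] express linear independence of the evaluation columns. *)
Record abm_invariant L GB N : Prop := AbmInvariant {
  inv_cover : forall u, [\/ u \in N,
    exists2 g, g \in GB & (lead_term le g <= u)%MM |
    exists2 v, v \in L & (v <= u)%MM];
  inv_L_GB : forall u g, u \in L -> g \in GB -> ~~ (lead_term le g <= u)%MM;
  inv_N_L : forall u v, u \in N -> v \in L -> le u v /\ u != v;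
  inv_uniq : uniq N;
  inv_inj : forall h, {subset msupp h <= N} -> evalv P h = 0 -> h = 0;
  inv_GB : forall g, g \in GB -> almost_vanishing N g }.

Lemma abm_invariant_init : abm_invariant [fset 0%MM]%fset [::] [::].
Proof.
split=> // [u|h h0 _].
  apply: Or33; exists 0%MM; rewrite ?inE //.
  by apply/mnm_lepP => i; rewrite mnm0E.
apply: msuppnil0; case: (msupp h) h0 => // u r /(_ u).
by rewrite inE eqxx => /(_ isT).
Qed.

(** A proper divisor [u] of [t] falls under [inv_cover]. A leading term dividing [u] would divide
    [t], and a term of [L] dividing [u] would be below [t], so [u] is in [N]. *)
Lemma min_term_corner L GB N t : abm_invariant L GB N ->
  t \in L -> (forall u, u \in L -> le t u) -> corner_set N t.
Proof.
move=> inv tL mint; split.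
  by apply/negP => tN; case: (inv_N_L inv tN tL); rewrite eqxx.
move=> u ut u_neq; case: (inv_cover inv u) => // -[v].
  by move=> vGB vu; case/negP: (inv_L_GB inv tL vGB); exact: lepm_trans vu ut.
move=> vL vu; case/eqP: u_neq; apply: (to_anti ord).
rewrite (term_ordering_dvd ord) //=.
exact: (to_trans ord) (mint _ vL) (term_ordering_dvd ord vu).
Qed.

Lemma abm_invariant_step_N L GB N t (c : 'cV[R]_(size N)) :
  t \in L -> (forall u, u \in L -> le t u) ->
  least_squares (evalmx P (in_tuple N)) (evalv P 'X_[t]) c ->
  eps < norm2 (evalv P 'X_[t] - evalmx P (in_tuple N) *m c)
        / norm2 (evalv P 'X_[t]) ->
  abm_invariant L GB N ->
  abm_invariant ((L `\ t) `|` [fset u in new_terms le GB t])%fset GB (rcons N t).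
Proof.
move=> tL mint ls big_res inv.
have [tN t_div] := min_term_corner inv tL mint.
have succ_new u : (u \in new_terms le GB t) ->
    (exists i, u = (U_(i) + t)%MM) /\
    forall g, g \in GB -> ~~ (lead_term le g <= u)%MM.
  rewrite mem_filter => /andP[/hasPn h /mapP[i _ ui]]; split; first by exists i.
  by move=> g /h.
split.
- move=> u; case: (inv_cover inv u) => [uN|[g gGB gu]|[v vL vu]].
  + by apply: Or31; rewrite mem_rcons inE uN orbT.
  + by apply: Or32; exists g.
  have [vt|vt] := eqVneq v t; last first.
    by apply: Or33; exists v => //; rewrite !inE vt vL.
  rewrite {}vt in vu; have [<-|tu] := eqVneq t u.
    by apply: Or31; rewrite mem_rcons inE eqxx.
  have [i iu] := dvd_succ_term vu tu.
  have [/hasP[g gGB gi]|noGB] :=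
    boolP (has (fun g => (lead_term le g <= U_(i) + t)%MM) GB).
    by apply: Or32; exists g => //; exact: lepm_trans gi iu.
  apply: Or33; exists (U_(i) + t)%MM => //; rewrite !inE /= mem_filter noGB /=.
  by rewrite (map_f (fun i => U_(i) + t)%MM) ?orbT // mem_enum.
- move=> u g; rewrite !inE => /orP[/andP[_ uL]|/succ_new[_ h]] gGB; last exact: h.
  exact: (inv_L_GB inv).
- have t_lt v : v \in ((L `\ t) `|` [fset u in new_terms le GB t])%fset ->
      le t v /\ t != v.
    rewrite !inE => /orP[/andP[vt vL]|/succ_new[[i ->] _]].
      by rewrite mint // eq_sym.
    rewrite eq_sym succ_term_neq; split=> //.
    exact/(term_ordering_dvd ord)/lem_addl.
  move=> u v; rewrite mem_rcons inE => /predU1P[->|uN] /t_lt[tv t_neq]; first by [].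
  have [ut u_neq] := inv_N_L inv uN tL; split; first exact: (to_trans ord) ut tv.
  apply: contraNneq u_neq => uv; apply/eqP/(to_anti ord).
  by rewrite ut uv tv.
- by rewrite rcons_uniq tN (inv_uniq inv).
- move=> h hN h0; pose a := h@_t.
  have supp_h' : {subset msupp (h - a *: 'X_[t]) <= N}.
    move=> u; rewrite mcoeff_msupp mcoeffB mcoeffZ mcoeffX.
    have [<-|tu] := eqVneq t u; first by rewrite mulr1 subrr eqxx.
    rewrite mulr0 subr0 -mcoeff_msupp => /hN.
    by rewrite mem_rcons inE eq_sym (negbTE tu).
  have [a0|a0] := eqVneq a 0.
    by apply: (inv_inj inv) => //; rewrite -[h]subr0 -(scale0r 'X_[t]) -a0.
  (* Solving [h] for ['X_[t]] gives a competitor supported in [N] with residual [a^-1 *: h], which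
     vanishes at the points; the least squares residual would then be 0. *)
  have supp_q : {subset msupp (- a^-1 *: (h - a *: 'X_[t])) <= N}.
    by move=> u /msuppZ_le; exact: supp_h'.
  have := @least_squares_poly _ _ _ P _ (in_tuple N) t c _ (inv_uniq inv) supp_q ls.
  have -> : 'X_[t] - - a^-1 *: (h - a *: 'X_[t]) = a^-1 *: h.
    by rewrite scaleNr opprK scalerBr scalerA mulVf // scale1r addrC subrK.
  rewrite evalvZ h0 scaler0 norm2_0 evalvB evalv_lincomb => res_le0.
  have res0 : norm2 (evalv P 'X_[t] - evalmx P (in_tuple N) *m c) = 0.
    by apply: le_anti; rewrite res_le0 norm2_ge0.
  by move: big_res; rewrite res0 mul0r => /(lt_trans eps_gt0); rewrite ltxx.
- move=> g gGB; have [t' [f [gE [t'N t'_div] fN lead_g opt]]] := inv_GB inv gGB.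
  exists t', f; split=> //; last by move=> u /fN uN; rewrite mem_rcons inE uN orbT.
  split; last by move=> u ut u_neq; rewrite mem_rcons inE t'_div ?orbT.
  (* An earlier corner [t'] stays outside the enlarged [N]: it is a leading term, whereas [t],
     coming from [L], is a multiple of none. *)
  rewrite mem_rcons inE (negbTE t'N) orbF -lead_g.
  apply: contra (inv_L_GB inv tL gGB) => /eqP ->; exact: lepm_refl.
Qed.

(** What is removed from [L] is covered by the new leading term [t], and least squares supplies the
    optimality stored in [almost_vanishing]. *)
Lemma abm_invariant_step_GB L GB N t (c : 'cV[R]_(size N)) :
  t \in L -> (forall u, u \in L -> le t u) ->
  least_squares (evalmx P (in_tuple N)) (evalv P 'X_[t]) c ->
  abm_invariant L GB N ->
  abm_invariant [fset u in L | ~~ (t <= u)%MM]%fset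
    (rcons GB ('X_[t] - lincomb (in_tuple N) c)) N.
Proof.
move=> tL mint ls inv; set f := lincomb _ c; set g := 'X_[t] - f.
have corner_t := min_term_corner inv tL mint; have [tN t_div] := corner_t.
have fN : {subset msupp f <= N} by move=> u /msupp_lincomb.
have lead_g : lead_term le g = t.
  apply: (lead_term_eq ord).
    rewrite mcoeff_msupp mcoeffB mcoeffX eqxx (@memN_msupp_eq0 _ _ f).
      by rewrite subr0 oner_eq0.
    by apply: contra tN; exact: fN.
  move=> u /msuppB_le; rewrite mem_cat msuppX inE => /predU1P[->|/fN uN].
    exact: (to_refl ord).
  by case: (inv_N_L inv uN tL).
split.
- move=> u; case: (inv_cover inv u) => [uN|[h hGB hu]|[v vL vu]].
  + exact: Or31.
  + by apply: Or32; exists h => //; rewrite mem_rcons inE hGB orbT.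
  have [tv|tv] := boolP (t <= v)%MM.
    apply: Or32; exists g; rewrite ?mem_rcons ?inE ?eqxx // lead_g.
    exact: lepm_trans tv vu.
  by apply: Or33; exists v => //; rewrite !inE vL.
- move=> u h; rewrite !inE mem_rcons inE => /andP[uL tu] /predU1P[->|hGB].
    by rewrite lead_g.
  exact: (inv_L_GB inv).
- by move=> u v uN; rewrite !inE => /andP[vL _]; exact: (inv_N_L inv).
- exact: (inv_uniq inv).
- exact: (inv_inj inv).
move=> h; rewrite mem_rcons inE => /predU1P[->|]; last exact: (inv_GB inv).
exists t, f; split=> // u a uf; rewrite /g -addrA -opprD.
apply: least_squares_poly ls; first exact: (inv_uniq inv).
move=> v /msuppD_le; rewrite mem_cat => /orP[/fN //|/msuppZ_le].
by rewrite msuppX inE => /eqP ->; exact: fN.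
Qed.

Lemma abm_reachable_invariant st : abm_reachable le P eps st ->
  abm_invariant (abm_L st) (abm_GB st) (abm_N st).
Proof.
elim=> [|x y _ inv step]; first exact: abm_invariant_init.
case: step inv => /= L GB N t c tL mint ls res inv.
  exact: abm_invariant_step_N ls res inv.
exact: abm_invariant_step_GB ls inv.
Qed.

End AbmInvariant.

(* [g = 'X_[t] - f] with residual [M d].  Subtracting the interpolant
   [lincomb N d] moves every coefficient by at most [delta]; if some [d k]
   attains [delta], then [d] is supported at [k] and optimality of [f] forces
   the coefficient of [g] there to vanish, so that a slight scaling down of the
   exact interpolant makes all inequalities strict. *)
Lemma almost_vanishing_pseudozero (R : realType) (s m : nat)
    (le : rel 'X_{1..s}) (P : 'I_m -> 'rV[R]_s) (N : m.-tuple 'X_{1..s})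
    (g : {mpoly R[s]}) (d : 'cV[R]_m) (delta : R) :
  uniq N -> almost_vanishing le P N g ->
  evalmx P N *m d = evalv P g -> 0 < delta -> norm2 d <= delta ->
  evalv P g != 0 ->
  pseudozero_set (fun t => t \in N \/ corner_set N t) g delta P.
Proof.
move=> uN [t [f [gE ct fN _ opt]]] Md delta_gt0 d_le g_neq0.
pose l := lincomb N d; have lN : {subset msupp l <= N} := @msupp_lincomb _ _ _ N d.
have tN : t \notin N by case: ct.
have coeff0 (h : {mpoly R[s]}) j : {subset msupp h <= N} -> j \notin N -> h@_j = 0.
  by move=> hN; apply: contraNeq; rewrite -mcoeff_msupp; exact: hN.
have coeff_gN j : j \in N -> g@_j = - f@_j.
  move=> jN; rewrite gE mcoeffB mcoeffX; have [tj|_] := eqVneq t j.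
    by rewrite tj jN in tN.
  by rewrite sub0r.
have coeff_gC j : j \notin N -> g@_j = (t == j)%:R.
  by move=> jN; rewrite gE mcoeffB mcoeffX coeff0 ?subr0.
have eval0 a : forall k, (a *: (g - l)).@[P k 0] = 0.
  by apply/evalv_eq0P; rewrite evalvZ evalvB evalv_lincomb Md subrr scaler0.
have supp a : supported (fun t => t \in N \/ corner_set N t) (a *: (g - l)).
  move=> j /msuppZ_le /msuppB_le; rewrite mem_cat gE => /orP[|/lN]; last by left.
  move=> /msuppB_le; rewrite mem_cat msuppX inE => /orP[/eqP ->|/fN]; last by left.
  by right.
have delta_neq0 : (delta == 0) = false by rewrite gt_eqF.
have [/existsP[k dk]|/existsPn d_lt] := boolP [exists k, delta <= `|d k 0|]; last first.
  exists (1 *: (g - l)); split=> //; split=> // j _; rewrite delta_neq0 scale1r.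
  rewrite mcoeffB addrAC subrr add0r normrN.
  have [/tnthP[k ->]|jN] := boolP (j \in N); last by rewrite coeff0 ?normr0.
  by rewrite mcoeff_lincomb // ltNge d_lt.
have d0 j : j != k -> d j 0 = 0.
  by apply: norm2_le_coord; exact: le_trans d_le dk.
(* Here [l] is the single term [d k 0 *: 'X_[tnth N k]]. Were this coefficient nonzero, [opt] would
   compare [g] with [g - l], which vanishes at the points. *)
have fk : f@_(tnth N k) = 0.
  apply: contraNeq g_neq0; rewrite -mcoeff_msupp => /(opt _ (d k 0)).
  have -> : d k 0 *: 'X_[tnth N k] = l.
    rewrite /l /lincomb (bigD1 k) //= big1 ?addr0 // => j jk.
    by rewrite d0 // scale0r.
  rewrite evalvB evalv_lincomb Md subrr norm2_0 => g_le0.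
  by rewrite -norm2_eq0 eq_le g_le0 norm2_ge0.
pose B := \sum_j `|f@_(tnth N j)|.
have B_ge0 : 0 <= B by exact: sumr_ge0.
have le_B j : `|f@_(tnth N j)| <= B.
  by rewrite /B (bigD1 j) //= lerDl sumr_ge0.
(* Scaling by [1 - eta] changes the coefficient at [t] by [eta], those in [N] other than the [k]-th
   by at most [eta * B], and the [k]-th by [(1 - eta) * |d k 0|]; all are below [delta]. *)
pose eta := delta / (B + delta + 1).
have den_gt0 : 0 < B + delta + 1 by lra.
have eta_gt0 : 0 < eta by exact: divr_gt0.
have eta_lt1 : eta < 1 by rewrite ltr_pdivrMr //; lra.
have eta_ltd : eta * (B + 1) < delta.
  rewrite /eta mulrAC ltr_pdivrMr // ltr_pM2l //; lra.
exists ((1 - eta) *: (g - l)); split=> //; split=> // j _; rewrite delta_neq0.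
rewrite mcoeffZ mcoeffB.
have [/tnthP[i ->]|jN] := boolP (j \in N); last first.
  rewrite [l@__]coeff0 // coeff_gC // subr0 -{2}[(t == j)%:R]mul1r -mulrBl.
  rewrite addrAC subrr add0r normrM normrN (gtr0_norm eta_gt0) normr_nat.
  by case: (t == j); rewrite ?mulr0 // mulr1; nra.
rewrite coeff_gN ?mem_tnth // mcoeff_lincomb //; have [->|ik] := eqVneq i k.
  rewrite fk oppr0 sub0r subr0 normrM normrN gtr0_norm ?subr_gt0 //.
  have := norm_coord_le_norm2 d k; nra.
rewrite d0 // subr0 opprK mulrN mulrBl mul1r opprB subrK normrM gtr0_norm //.
have := le_B i; nra.
Qed.

Theorem theorem5p2 (R : realType) (s m n : nat) (le : rel 'X_{1..s})
    (eps : R) (P : 'I_m -> 'rV[R]_s)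
    (GB : n.-tuple {mpoly R[s]}) (N : m.-tuple 'X_{1..s}) (sigma_min : R) :
  term_ordering le ->
  0 < eps ->
  injective P ->
  abm_output le P eps GB N ->
  min_singular_value (evalmx P N) sigma_min ->
  let S := fun t : 'X_{1..s} => t \in N \/ corner_set N t in
  let delta := fun i : 'I_n => norm2 (evalv P (tnth GB i)) / sigma_min in
  pseudozero_set_system S GB delta P.
Proof.
move=> ord eps_gt0 _ out msv S delta i.
have /= inv := abm_reachable_invariant ord eps_gt0 out.
have av := inv_GB inv (mem_tnth i GB).
have suppS : supported S (tnth GB i).
  have [t [f [-> ct fN _ _]]] := av.
  move=> j /msuppB_le; rewrite mem_cat msuppX inE => /orP[/eqP ->|/fN]; last by left.
  by right.
split=> //.
have unitM := evalmx_unit (inv_uniq inv) (inv_inj inv).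
have sigma_gt0 : 0 < sigma_min.
  by rewrite lt_def (singular_value_unit_neq0 unitM msv.1) msv.1.1.
(* If [g] vanishes at the points, its tolerance is 0 and [g] itself is the witness. *)
have [g0|g_neq0] := eqVneq (evalv P (tnth GB i)) 0.
  exists (tnth GB i); split; last exact/evalv_eq0P.
  by split=> // j _; rewrite /delta g0 norm2_0 mul0r eqxx.
have Md : evalmx P N *m (invmx (evalmx P N) *m evalv P (tnth GB i))
          = evalv P (tnth GB i) by rewrite mulKVmx.
apply: (almost_vanishing_pseudozero (inv_uniq inv) av Md) => //.
  by rewrite divr_gt0 // norm2_gt0.
by rewrite /delta ler_pdivlMr // mulrC -{2}Md min_singular_value_le.
Qed.
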